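(* Let $\phi(t)=(q(t),p(t))$ be a Kepler orbit with positive energy $H>0$, and write $S_+(\phi(t))=(r(t),s(t),\sqrt{2H})$. Then $S_+$ sends the orbit to a (reparametrized) geodesic in the unit cotangent bundle of $H_+^3$: there are a unit-speed geodesic $\gamma$ of $H^3_+$ and a smooth strictly monotone function $\theta(t)$ such that $r(t)=\gamma(\theta(t))$ and $s(t)=\gamma'(\theta(t))$ for all $t$.
   Context: The Kepler Hamiltonian is $H(q,p)=\frac12|p|^2-|q|^{-1}$ on $\{(q,p)\in\mathbb R^3\times\mathbb R^3: q\ne0\}$; a Kepler orbit is a solution of $\dot q=p$, $\dot p=-q/|q|^3$. On $\mathbb R^{1,3}$ use the Minkowski form $\langle x,y\rangle_{(1,3)}=x_0y_0-x_1y_1-x_2y_2-x_3y_3$; hyperbolic space is $H_+^3=\{x\in\mathbb R^{1,3}:\langle x,x\rangle_{(1,3)}=1,\ x_0>0\}$, whose Riemannian metric is the restriction of $-\langle\cdot,\cdot\rangle_{(1,3)}$. Its unit (co)tangent bundle is $T_1^*H_+^3=\{(x,y): x\in H_+^3,\ \langle x,y\rangle_{(1,3)}=0,\ \langle y,y\rangle_{(1,3)}=-1\}$. On $\Sigma_+=\{(q,p): q\ne0,\ H(q,p)>0\}$ define $S_+(q,p)=[(r_0,\bar r),(s_0,\bar s),\sqrt{2H}]\in T_1^*H^3_+\times\mathbb R_{>0}$, where $$r_0=|p|^2|q|-1,\quad \bar r=-\sqrt{2H}\,|q|\,p,\quad s_0=-\sqrt{2H}\,\langle q,p\rangle,\quad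 \bar s=-\Big(\frac{q}{|q|}-\langle q,p\rangle p\Big).$$ *)

(* Defs.v *)
From HB Require Import structures.
From mathcomp Require Import all_boot all_order all_algebra.
From mathcomp Require Import all_classical all_reals all_analysis.

Set Implicit Arguments.
Unset Strict Implicit.
Unset Printing Implicit Defensive.

Import Order.TTheory GRing.Theory Num.Theory.
Import numFieldNormedType.Exports.

Local Open Scope classical_set_scope.
Local Open Scope ring_scope.

(* The library norm on row vectors is the sup norm, hence [dot] and [enorm]. *)

Definition dot (R : realType) (n : nat) (u v : 'rV[R]_n) : R :=
  \sum_(i < n) u 0 i * v 0 i.

Definition enorm (R : realType) (n : nat) (u : 'rV[R]_n) : R :=
  Num.sqrt (dot u u).

(* The derivatives of f at a point depend only on the germ of f there, so for
   open I the values of f outside I are irrelevant. *)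
Definition smooth_on (R : realType) (V : normedModType R) (I : set R)
    (f : R -> V) : Prop :=
  forall (n : nat) (t : R), I t -> derivable (derive1n n f) t 1.

Definition strictly_monotone_on (R : realType) (I : set R) (f : R -> R) : Prop :=
  (forall x y, I x -> I y -> x < y -> f x < f y) \/
  (forall x y, I x -> I y -> x < y -> f y < f x).

Definition open_interval (R : realType) (I : set R) : Prop :=
  [/\ I !=set0, open I & is_interval I].

(* Points of phase space are pairs z = (q, p). *)

Definition hamiltonian (R : realType) (z : 'rV[R]_3 * 'rV[R]_3) : R :=
  2^-1 * enorm z.2 ^+ 2 - (enorm z.1)^-1.

Definition kepler_orbit (R : realType) (I : set R)
    (phi : R -> 'rV[R]_3 * 'rV[R]_3) : Prop :=
  forall t, I t ->
    [/\ (phi t).1 != 0,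
        is_derive t 1 (fun u => (phi u).1) (phi t).2
      & is_derive t 1 (fun u => (phi u).2)
          (- (enorm (phi t).1 ^- 3 *: (phi t).1))].

Definition Sigma_plus (R : realType) : set ('rV[R]_3 * 'rV[R]_3) :=
  [set z | z.1 != 0 /\ 0 < hamiltonian z].

(* R^{1,3} is 'rV_(1 + 3), split as a time block and a space block. *)

Definition vec13 (R : realType) (x0 : R) (xbar : 'rV[R]_3) : 'rV[R]_(1 + 3) :=
  row_mx (const_mx x0) xbar.

Definition time (R : realType) (x : 'rV[R]_(1 + 3)) : R := lsubmx x 0 0.

Definition mink (R : realType) (x y : 'rV[R]_(1 + 3)) : R :=
  time x * time y - dot (rsubmx x) (rsubmx y).

Definition hyperboloid (R : realType) : set 'rV[R]_(1 + 3) :=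
  [set x | mink x x = 1 /\ 0 < time x].

Definition unit_cotangent (R : realType) :
    set ('rV[R]_(1 + 3) * 'rV[R]_(1 + 3)) :=
  [set z | [/\ hyperboloid z.1, mink z.1 z.2 = 0 & mink z.2 z.2 = -1]].

Definition hyp_metric (R : realType) (v w : 'rV[R]_(1 + 3)) : R := - mink v w.

(* Orthogonal projection of R^{1,3} onto the tangent space
   {w | mink x w = 0} of the hyperboloid at x. *)
Definition tanproj (R : realType) (x v : 'rV[R]_(1 + 3)) : 'rV[R]_(1 + 3) :=
  v - mink v x *: x.

(* Covariant derivative along gamma of a tangent field V: the Levi-Civita
   connection of the induced metric is the tangential part of the flat ambient
   derivative. *)
Definition covderiv (R : realType) (gamma V : R -> 'rV[R]_(1 + 3)) (t : R) :
    'rV[R]_(1 + 3) :=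
  tanproj (gamma t) (derive1 V t).

Definition geodesic (R : realType) (gamma : R -> 'rV[R]_(1 + 3)) : Prop :=
  [/\ smooth_on setT gamma,
      (forall t, hyperboloid (gamma t))
    & (forall t, covderiv gamma (derive1 gamma) t = 0)].

Definition unit_speed (R : realType) (gamma : R -> 'rV[R]_(1 + 3)) : Prop :=
  forall t, hyp_metric (derive1 gamma t) (derive1 gamma t) = 1.

Definition S_plus (R : realType) (z : 'rV[R]_3 * 'rV[R]_3) :
    'rV[R]_(1 + 3) * 'rV[R]_(1 + 3) * R :=
  let q := z.1 in let p := z.2 in
  let k := Num.sqrt (2 * hamiltonian z) in
  (vec13 (enorm p ^+ 2 * enorm q - 1) (- ((k * enorm q) *: p)),
   vec13 (- (k * dot q p)) (- ((enorm q)^-1 *: q - dot q p *: p)),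
   k).

Lemma minkBr (R : realType) (x y z : 'rV[R]_(1 + 3)) :
  mink x (y - z) = mink x y - mink x z.
Proof.
rewrite /mink /dot /time opprD addrACA -opprD; congr (_ + _).
  by rewrite !mxE mulrBr.
congr (- _); rewrite -sumrB; apply: eq_bigr => i _.
by rewrite !mxE mulrBr.
Qed.

Lemma minkZr (R : realType) (a : R) (x y : 'rV[R]_(1 + 3)) :
  mink x (a *: y) = a * mink x y.
Proof.
rewrite /mink /dot /time mulrBr mulr_sumr; congr (_ - _).
  by rewrite !mxE mulrCA.
by apply: eq_bigr => i _; rewrite !mxE mulrCA.
Qed.

Lemma minkC (R : realType) (x y : 'rV[R]_(1 + 3)) : mink x y = mink y x.
Proof.
rewrite /mink /dot mulrC; congr (_ - _).
by apply: eq_bigr => i _; rewrite mulrC.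
Qed.

Lemma tanproj_tangent (R : realType) (x v : 'rV[R]_(1 + 3)) :
  hyperboloid x -> mink x (tanproj x v) = 0.
Proof. by case=> xx _; rewrite minkBr minkZr xx mulr1 minkC subrr. Qed.

Lemma tanproj_normal (R : realType) (x v w : 'rV[R]_(1 + 3)) :
  mink x w = 0 -> mink (v - tanproj x v) w = 0.
Proof.
move=> xw; rewrite /tanproj opprB addrC subrK.
by rewrite minkC minkZr [mink w x]minkC xw mulr0.
Qed.

(* Main.v *)
(* Along a Kepler orbit of energy H = k^2 / 2 the components of S_+ = (r, s, k)
   satisfy r' = theta' s and s' = theta' r with theta' = - k / |q|. Hence
   exp(-theta) (r + s) and exp(theta) (r - s) are constant, so r and s are the
   position and the velocity, at time theta, of the hyperbolic line
   cosh(tau) r(t0) + sinh(tau) s(t0). Since <q, p>' = k^2 + 1 / |q|, one can take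
   theta = k^3 (t - t0) - k (<q, p>(t) - <q, p>(t0)). This is smooth because t,
   the coordinates of q and p, and 1 / |q| generate an algebra of functions that
   is stable under differentiation. *)
Require Import Defs.
From HB Require Import structures.
From mathcomp Require Import all_boot all_order all_algebra.
From mathcomp Require Import all_classical all_reals all_analysis.
From mathcomp Require Import ring lra.
Import Order.TTheory GRing.Theory Num.Theory.
Import numFieldNormedType.Exports.
Local Open Scope classical_set_scope.
Local Open Scope ring_scope.

(** * Entrywise calculus, constancy on intervals and a smoothness criterion *)

Lemma is_derive_mxP {R : realType} {m n : nat} (M : R -> 'M[R]_(m, n)) (t v : R)
    (dM : 'M[R]_(m, n)) :
  is_derive t v M dM <-> forall i j, is_derive t v (fun x => M x i j) (dM i j).
Proof.
split=> [[dMt <-] i j|dMt].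
  split; first by move/derivable_mxP : dMt.
  by rewrite derive_mx// mxE.
have dM1 : derivable M t v by apply/derivable_mxP => i j; case: (dMt i j).
split=> //; rewrite derive_mx//; apply/matrixP => i j; rewrite mxE.
by case: (dMt i j).
Qed.

Lemma is_derive_scale {R : realType} {m n : nat} {a : R -> R}
    {M : R -> 'M[R]_(m, n)} {t da : R} {dM : 'M[R]_(m, n)} :
  is_derive t 1 a da -> is_derive t 1 M dM ->
  is_derive t 1 (fun x => a x *: M x) (da *: M t + a t *: dM).
Proof.
move=> ha /is_derive_mxP hM; apply/is_derive_mxP => i j.
rewrite !mxE; have hMij := hM i j.
have -> : (fun x => (a x *: M x) i j) = a * (fun x => M x i j).
  by apply/funext => x; rewrite mxE.
by apply: is_derive_eq; rewrite /GRing.scale /=; ring.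
Qed.

Lemma is_derive_dot {R : realType} {n : nat} {f g : R -> 'rV[R]_n} {t : R}
    {df dg : 'rV[R]_n} :
  is_derive t 1 f df -> is_derive t 1 g dg ->
  is_derive t 1 (fun x => dot (f x) (g x)) (dot df (g t) + dot (f t) dg).
Proof.
move=> /is_derive_mxP hf /is_derive_mxP hg.
have -> : (fun x => dot (f x) (g x)) =
    \sum_(i < n) ((fun x => f x 0 i) * (fun x => g x 0 i)).
  by apply/funext => x; rewrite fct_sumE.
have hfi i := hf 0 i; have hgi i := hg 0 i.
apply: is_derive_eq; rewrite /dot -big_split; apply: eq_bigr => i _ /=.
by rewrite /GRing.scale /=; ring.
Qed.

Lemma is_derive_vec13 {R : realType} {f : R -> R} {g : R -> 'rV[R]_3} {t df : R}
    {dg : 'rV[R]_3} :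
  is_derive t 1 f df -> is_derive t 1 g dg ->
  is_derive t 1 (fun x => vec13 (f x) (g x)) (vec13 df dg).
Proof.
move=> hf /is_derive_mxP hg; apply/is_derive_mxP => i j.
rewrite (ord1 i) -(splitK j); case: (fintype.split j) => k.
  rewrite /vec13 /= row_mxEl mxE.
  suff -> : (fun x => row_mx (const_mx (f x)) (g x) 0 (lshift 3 k)) = f by [].
  by apply/funext => x; rewrite row_mxEl mxE.
rewrite /vec13 /= row_mxEr.
suff -> : (fun x => row_mx (const_mx (f x)) (g x) 0 (rshift 1 k)) =
  (fun x => g x 0 k) by [].
by apply/funext => x; rewrite row_mxEr.
Qed.

(** Differentiability at the points of [I] gives continuity on the segment from [x] to [y], which
    lies in [I]. It serves both for conservation laws and for the monotonicity of the
    reparametrization. *)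
Lemma MVT_is_interval {R : realType} {I : set R} {f df : R -> R} {x y : R} :
  is_interval I -> (forall t, I t -> is_derive t 1 f (df t)) ->
  I x -> I y -> x < y -> exists2 c, I c & f y - f x = df c * (y - x).
Proof.
move=> itvI hf Ix Iy xy.
have sub z : z \in `[x, y] -> I z by rewrite in_itv => /itvI; apply.
have [z zxy||c cxy ->] := @MVT _ f df x y xy.
- by apply/hf/sub; apply: subset_itv_oo_cc.
- apply: derivable_within_continuous => z /sub /hf; by case.
- by exists c => //; apply/sub; apply: subset_itv_oo_cc.
Qed.

Lemma is_derive0_cst_on {R : realType} {I : set R} {f : R -> R} {x y : R} :
  is_interval I -> (forall t, I t -> is_derive t 1 f 0) ->
  I x -> I y -> f x = f y.
Proof.
move=> itvI hf; wlog xy : x y / x <= y.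
  move=> h Ix Iy; have [xy|/ltW xy] := leP x y; first exact: h.
  by apply/esym/h.
move: xy; rewrite le_eqVlt => /predU1P[->//|xy] Ix Iy.
have [c _ /eqP] := MVT_is_interval itvI hf Ix Iy xy.
by rewrite mul0r subr_eq0 => /eqP.
Qed.

Lemma is_derive0_mx_cst_on {R : realType} {m n : nat} {I : set R}
    {M : R -> 'M[R]_(m, n)} {x y : R} :
  is_interval I -> (forall t, I t -> is_derive t 1 M 0) ->
  I x -> I y -> M x = M y.
Proof.
move=> itvI hM Ix Iy; apply/matrixP => i j.
apply: (is_derive0_cst_on (f := fun t => M t i j) itvI) => // t.
by move=> /hM /is_derive_mxP /(_ i j); rewrite mxE.
Qed.

(** By induction on the order, every iterated derivative agrees on [I] with some member of [C]. As
    [I] is open, agreement on [I] is agreement near each of its points, so derivability and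
    derivatives carry over. *)
Lemma smooth_on_derive_closed {R : realType} {V : normedModType R} (I : set R)
    (C : set (R -> V)) : open I ->
  (forall f, C f -> exists2 g, C g & forall t, I t -> is_derive t 1 f (g t)) ->
  forall f, C f -> smooth_on I f.
Proof.
move=> oI hC f Cf n.
have [g Cg fg] : exists2 g, C g & forall t, I t -> derive1n n f t = g t.
  elim: n => [|n [g Cg fg]]; first by exists f.
  have [h Ch gh] := hC _ Cg; exists h => // t It.
  rewrite derive1nS derive1E; case: (gh t It) => _ <-.
  apply: near_eq_derive; near=> x; apply: fg; near: x.
  exact: open_nbhs_nbhs.
move=> t It; have [h _ /(_ _ It)[dg _]] := hC _ Cg.
apply: near_eq_derivable dg; near=> x; apply/esym/fg; near: x.
exact: open_nbhs_nbhs.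
Unshelve. all: by end_near. Qed.

(** * Algebra of the Minkowski form and of the Euclidean product *)

Lemma mink_vec13 {R : realType} (a b : R) (x y : 'rV[R]_3) :
  mink (vec13 a x) (vec13 b y) = a * b - dot x y.
Proof. by rewrite /mink /time /vec13 !row_mxKl !row_mxKr !mxE. Qed.

Lemma vec13Z {R : realType} (c a : R) (x : 'rV[R]_3) :
  c *: vec13 a x = vec13 (c * a) (c *: x).
Proof.
rewrite /vec13 scale_row_mx; congr row_mx.
by apply/matrixP => i j; rewrite !mxE.
Qed.

Lemma minkDr {R : realType} (x y z : 'rV[R]_(1 + 3)) :
  mink x (y + z) = mink x y + mink x z.
Proof.
by rewrite -[z in LHS]opprK minkBr -[- z]scaleN1r minkZr; ring.
Qed.

Lemma minkDl {R : realType} (x y z : 'rV[R]_(1 + 3)) :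
  mink (x + y) z = mink x z + mink y z.
Proof. by rewrite minkC minkDr ![mink z _]minkC. Qed.

Lemma minkZl {R : realType} (a : R) (x y : 'rV[R]_(1 + 3)) :
  mink (a *: x) y = a * mink x y.
Proof. by rewrite minkC minkZr minkC. Qed.

Lemma dotC {R : realType} {n : nat} (u v : 'rV[R]_n) : dot u v = dot v u.
Proof. by apply: eq_bigr => i _; rewrite mulrC. Qed.

Lemma dotDr {R : realType} {n : nat} (u v w : 'rV[R]_n) :
  dot u (v + w) = dot u v + dot u w.
Proof. by rewrite -big_split; apply: eq_bigr => i _; rewrite mxE mulrDr. Qed.

Lemma dotZr {R : realType} {n : nat} (a : R) (u v : 'rV[R]_n) :
  dot u (a *: v) = a * dot u v.
Proof. by rewrite /dot mulr_sumr; apply: eq_bigr => i _; rewrite mxE mulrCA. Qed.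

Lemma dotNr {R : realType} {n : nat} (u v : 'rV[R]_n) :
  dot u (- v) = - dot u v.
Proof. by rewrite -scaleN1r dotZr mulN1r. Qed.

Lemma dotDl {R : realType} {n : nat} (u v w : 'rV[R]_n) :
  dot (u + v) w = dot u w + dot v w.
Proof. by rewrite dotC dotDr ![dot w _]dotC. Qed.

Lemma dotZl {R : realType} {n : nat} (a : R) (u v : 'rV[R]_n) :
  dot (a *: u) v = a * dot u v.
Proof. by rewrite dotC dotZr dotC. Qed.

Lemma dotNl {R : realType} {n : nat} (u v : 'rV[R]_n) :
  dot (- u) v = - dot u v.
Proof. by rewrite dotC dotNr dotC. Qed.

Definition dotE {R : realType} {n : nat} :=
  (@dotDl R n, @dotDr R n, @dotZl R n, @dotZr R n, @dotNl R n, @dotNr R n).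

Lemma dot_ge0 {R : realType} {n : nat} (u : 'rV[R]_n) : 0 <= dot u u.
Proof. by apply: sumr_ge0 => i _; rewrite -expr2 sqr_ge0. Qed.

Lemma dot_gt0 {R : realType} {n : nat} (u : 'rV[R]_n) : u != 0 -> 0 < dot u u.
Proof.
apply: contraNT; rewrite -leNgt => u0; apply/eqP/rowP => i; rewrite mxE.
have /eqP := le_anti (introT andP (conj u0 (dot_ge0 u))).
rewrite psumr_eq0; last by move=> j _; rewrite -expr2 sqr_ge0.
by move=> /allP /(_ i); rewrite mem_index_enum -expr2 sqrf_eq0 => /(_ isT) /eqP.
Qed.

Lemma enorm_sqr {R : realType} {n : nat} (u : 'rV[R]_n) :
  enorm u ^+ 2 = dot u u.
Proof. by rewrite sqr_sqrtr ?dot_ge0. Qed.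

Lemma enorm_gt0 {R : realType} {n : nat} (u : 'rV[R]_n) : u != 0 -> 0 < enorm u.
Proof. by move=> u0; rewrite sqrtr_gt0 dot_gt0. Qed.

(** * Hyperbolic lines as unit-speed geodesics *)

(** This is cosh(tau) x + sinh(tau) y. In exponential form the coefficients are x + y and x - y, and
    differentiation in tau just exchanges x and y. *)
Definition hyp_line {R : realType} (x y : 'rV[R]_(1 + 3)) (tau : R) :=
  expR tau *: (2^-1 *: (x + y)) + expR (- tau) *: (2^-1 *: (x - y)).

Lemma is_derive_expRN {R : realType} (t : R) :
  is_derive t 1 (fun x => expR (- x)) (- expR (- t)).
Proof.
have h := is_deriveNid t (1 : R).
by apply: is_derive_eq (is_derive1_comp _ h) _; ring.
Qed.

Lemma is_derive_hyp_line {R : realType} (x y : 'rV[R]_(1 + 3)) (t : R) :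
  is_derive t 1 (hyp_line x y) (hyp_line y x t).
Proof.
have h1 := is_derive_scale (is_derive_expR t)
  (is_derive_cst (2^-1 *: (x + y)) t 1).
have h2 := is_derive_scale (is_derive_expRN t)
  (is_derive_cst (2^-1 *: (x - y)) t 1).
apply: is_derive_eq (is_deriveD h1 h2) _.
by rewrite !scaler0 !addr0 scaleNr -!scalerN opprB (addrC x).
Qed.

Lemma derive1_hyp_line {R : realType} (x y : 'rV[R]_(1 + 3)) :
  derive1 (hyp_line x y) = hyp_line y x.
Proof.
apply/funext => t; rewrite derive1E.
by case: (is_derive_hyp_line x y t).
Qed.

(** Both x + y and x - y are null vectors and their product is 2, so only the cross terms survive,
    where the two exponentials cancel. *)
Lemma mink_hyp_line {R : realType} (x y : 'rV[R]_(1 + 3)) (t : R) :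
  unit_cotangent (x, y) -> mink (hyp_line x y t) (hyp_line x y t) = 1.
Proof.
move=> [[/= xx _] xy yy].
rewrite /hyp_line !(minkDl, minkDr, minkZl, minkZr) -![- y]scaleN1r.
rewrite !(minkZl, minkZr) xx yy (minkC y x) xy expRN.
by field; rewrite gt_eqF ?expR_gt0.
Qed.

Lemma mink_hyp_line_deriv {R : realType} (x y : 'rV[R]_(1 + 3)) (t : R) :
  unit_cotangent (x, y) -> mink (hyp_line y x t) (hyp_line y x t) = -1.
Proof.
move=> [[/= xx _] xy yy].
rewrite /hyp_line !(minkDl, minkDr, minkZl, minkZr) -![- x]scaleN1r.
rewrite !(minkZl, minkZr) xx yy (minkC y x) xy expRN.
by field; rewrite gt_eqF ?expR_gt0.
Qed.

Lemma time_hyp_line {R : realType} (x y : 'rV[R]_(1 + 3)) (t : R) :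
  time (hyp_line x y t) =
  expR t * (2^-1 * (time x + time y)) + expR (- t) * (2^-1 * (time x - time y)).
Proof. by rewrite /time !mxE. Qed.

(* Expanding [0 <= |y_0 xbar - x_0 ybar|^2] turns the right-hand side into
   [x_0^2 - y_0^2]. *)
Lemma unit_cotangent_time_le {R : realType} (x y : 'rV[R]_(1 + 3)) :
  unit_cotangent (x, y) -> time y ^+ 2 <= time x ^+ 2.
Proof.
move=> [[/= xx _] xy yy].
have := dot_ge0 (time y *: rsubmx x - time x *: rsubmx y).
move: xx xy yy; rewrite /mink !dotE (dotC (rsubmx y)) => xx xy yy.
have -> : dot (rsubmx x) (rsubmx x) = time x * time x - 1 by lra.
have -> : dot (rsubmx x) (rsubmx y) = time x * time y by lra.
have -> : dot (rsubmx y) (rsubmx y) = time y * time y + 1 by lra.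
by move=> h; lra.
Qed.

(** To stay on the upper sheet: |y_0| <= x_0 makes both exponential coefficients of the time
    component nonnegative. That component cannot vanish, since the form would then be <= 0 instead
    of 1. *)
Lemma hyp_line_hyperboloid {R : realType} (x y : 'rV[R]_(1 + 3)) (t : R) :
  unit_cotangent (x, y) -> hyperboloid (hyp_line x y t).
Proof.
move=> xy; have h := mink_hyp_line x y t xy; split=> //.
have [[/= _ x0] _ _] := xy.
have /andP[yx1 yx2] : - time x <= time y <= time x.
  rewrite -ler_norml -(gtr0_norm x0) -ler_sqr ?nnegrE// !real_normK ?num_real//.
  exact: unit_cotangent_time_le.
have ge0 : 0 <= time (hyp_line x y t).
  rewrite time_hyp_line addr_ge0// mulr_ge0 ?expR_ge0//; lra.
rewrite lt_neqAle ge0 andbT; apply/eqP => t0.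
have := dot_ge0 (rsubmx (hyp_line x y t)).
move: h; rewrite /mink -t0; lra.
Qed.

(** Differentiating twice exchanges x and y twice, so the acceleration is the position vector
    itself, whose tangential part is zero. For smoothness, the family of all [hyp_line u v], with
    [u] and [v] arbitrary, is stable under differentiation. *)
Lemma hyp_line_geodesic {R : realType} (x y : 'rV[R]_(1 + 3)) :
  unit_cotangent (x, y) -> geodesic (hyp_line x y).
Proof.
move=> xy; split.
- apply: (smooth_on_derive_closed _ (range (fun z => hyp_line z.1 z.2))) => //.
  + exact: openT.
  + move=> _ [[u v] _ <-]; exists (hyp_line v u); first by exists (v, u).
    by move=> t _; exact: is_derive_hyp_line.
  + by exists (x, y).
- by move=> t; exact: hyp_line_hyperboloid.
- move=> t; rewrite /covderiv /tanproj !derive1_hyp_line.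
  by rewrite mink_hyp_line// scale1r subrr.
Qed.

Lemma hyp_line_unit_speed {R : realType} (x y : 'rV[R]_(1 + 3)) :
  unit_cotangent (x, y) -> unit_speed (hyp_line x y).
Proof.
move=> xy t; rewrite /hyp_metric derive1_hyp_line.
by rewrite mink_hyp_line_deriv// opprK.
Qed.

(** * Values of [S_plus] in the unit cotangent bundle *)

Lemma S_plus_unit_cotangent {R : realType} (z : 'rV[R]_3 * 'rV[R]_3) :
  Sigma_plus z -> unit_cotangent (S_plus z).1.
Proof.
case: z => q p [/= q0 H0].
have rho0 := enorm_gt0 _ q0; have rhoE := enorm_sqr q.
(* Positive energy allows the square root to be undone; this relation drives the two norm
   computations. *)
have k2 : Num.sqrt (2 * hamiltonian (q, p)) ^+ 2 = dot p p - 2 / enorm q.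
  rewrite sqr_sqrtr ?mulr_ge0 ?ltW// /hamiltonian /= enorm_sqr.
  by field; rewrite gt_eqF.
(* Positive energy again, multiplied by 2 |q|: it makes the time component |p|^2 |q| - 1
   positive. *)
have pp2 : 2 < dot p p * enorm q.
  move: H0; rewrite /hamiltonian /= enorm_sqr -(pmulr_lgt0 _ rho0) mulrBl.
  by rewrite mulVf ?gt_eqF//; lra.
rewrite /S_plus /=; set k := Num.sqrt _ in k2 *.
rewrite enorm_sqr.
(* With k and |q| abstracted, known only through k^2 and |q|^2 and sign conditions, the remaining
   equations are rational identities in k, |q|, |p|^2 and <q, p>. *)
move: k k2 rhoE rho0 pp2 {H0}; set rho := enorm q => k k2 rhoE rho0 pp2.
have rho1 : rho != 0 by rewrite gt_eqF.
split; [split| |]; rewrite ?mink_vec13 /= ?dotE ?(dotC p q) -?rhoE.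
- transitivity ((dot p p * rho - 1) ^+ 2 - k ^+ 2 * rho ^+ 2 * dot p p).
    by ring.
  by rewrite k2; field.
- by rewrite /time /vec13 row_mxKl mxE; lra.
- by field.
- set s := dot q p.
  by transitivity (k ^+ 2 * s ^+ 2 - (1 - 2 * s ^+ 2 / rho + s ^+ 2 * dot p p));
    [field|rewrite k2; field].
Qed.

(** * Function algebras stable under differentiation *)

(** The unital subalgebra generated by [G]; opposites and scalar multiples arise as products with
    constants. Being inductive, it lets the stability under differentiation be checked on
    generators. *)
Inductive generated_algebra {R : realType} (G : set (R -> R)) : set (R -> R) :=
| generated_gen g : G g -> generated_algebra G g
| generated_cst c : generated_algebra G (cst c)
| generatedD f g : generated_algebra G f -> generated_algebra G g ->
    generated_algebra G (f + g)
| generatedM f g : generated_algebra G f -> generated_algebra G g ->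
    generated_algebra G (f * g).

Lemma generated_sum {R : realType} (G : set (R -> R)) (n : nat)
    (F : 'I_n -> R -> R) :
  (forall i, generated_algebra G (F i)) -> generated_algebra G (\sum_(i < n) F i).
Proof.
move=> GF; apply: (big_ind (generated_algebra G)) => //.
- exact: (generated_cst G 0).
- by move=> f g; exact: generatedD.
Qed.

Lemma generated_dot {R : realType} (G : set (R -> R)) (n : nat)
    (f g : R -> 'rV[R]_n) :
  (forall i, generated_algebra G (fun t => f t 0 i)) ->
  (forall i, generated_algebra G (fun t => g t 0 i)) ->
  generated_algebra G (fun t => dot (f t) (g t)).
Proof.
move=> Gf Gg.
have -> : (fun t => dot (f t) (g t)) =
    \sum_(i < n) ((fun t => f t 0 i) * (fun t => g t 0 i)).
  by apply/funext => t; rewrite fct_sumE.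
by apply: generated_sum => i; exact: generatedM.
Qed.

(** The sum and product rules propagate stability under differentiation from the generators to the
    whole algebra, to which the smoothness criterion then applies. *)
Lemma generated_algebra_smooth {R : realType} (I : set R) (G : set (R -> R)) :
  open I ->
  (forall g, G g -> exists2 dg, generated_algebra G dg &
    forall t, I t -> is_derive t 1 g (dg t)) ->
  forall f, generated_algebra G f -> smooth_on I f.
Proof.
move=> oI dG; apply: (smooth_on_derive_closed _ (generated_algebra G) oI) => f.
elim=> {f} [g /dG//|c|f g Gf [df Gdf fE] Gg [dg Gdg gE]
  |f g Gf [df Gdf fE] Gg [dg Gdg gE]].
- by exists (cst 0) => [|t _]; [exact: generated_cst|exact: is_derive_cst].
- exists (df + dg); first exact: generatedD.
  by move=> t It; apply: is_deriveD; [exact: fE|exact: gE].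
- exists (f * dg + g * df); first by apply: generatedD; exact: generatedM.
  by move=> t It; apply: is_deriveM; [exact: fE|exact: gE].
Qed.

(** * Derivatives along a Kepler orbit *)

(** [hyp_pos] and [hyp_vel] are the two vectors of [S_plus] with the square root of 2H replaced by a
    free constant k. Along an orbit they can be differentiated without differentiating H. *)
Definition hyp_pos {R : realType} (k : R) (z : 'rV[R]_3 * 'rV[R]_3) :=
  vec13 (enorm z.2 ^+ 2 * enorm z.1 - 1) (- ((k * enorm z.1) *: z.2)).

Definition hyp_vel {R : realType} (k : R) (z : 'rV[R]_3 * 'rV[R]_3) :=
  vec13 (- (k * dot z.1 z.2))
    (- ((enorm z.1)^-1 *: z.1 - dot z.1 z.2 *: z.2)).

(* Since [dot q p] has derivative [k^2 + 1/|q|], this primitive of [- k / |q|]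
   needs no integral. *)
Definition hyp_time {R : realType} (k : R) (phi : R -> 'rV[R]_3 * 'rV[R]_3)
    (t0 t : R) :=
  k ^+ 3 * (t - t0)
  - k * (dot (phi t).1 (phi t).2 - dot (phi t0).1 (phi t0).2).

Lemma is_derive_kepler_enorm {R : realType} {I : set R}
    {phi : R -> 'rV[R]_3 * 'rV[R]_3} {t : R} :
  kepler_orbit I phi -> I t ->
  is_derive t 1 (fun u => enorm (phi u).1)
    (dot (phi t).1 (phi t).2 / enorm (phi t).1).
Proof.
move=> hphi It; have [q0 dq dp] := hphi t It.
have dqq := is_derive_dot dq dq.
have h := is_derive1_comp (is_derive1_sqrt (dot_gt0 _ q0)) dqq.
apply: is_derive_eq h _; rewrite (dotC (phi t).2) -/(enorm (phi t).1).
by field; rewrite gt_eqF ?enorm_gt0.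
Qed.

Lemma is_derive_kepler_dot {R : realType} {I : set R}
    {phi : R -> 'rV[R]_3 * 'rV[R]_3} {t : R} :
  kepler_orbit I phi -> I t ->
  is_derive t 1 (fun u => dot (phi u).1 (phi u).2)
    (dot (phi t).2 (phi t).2 - (enorm (phi t).1)^-1).
Proof.
move=> hphi It; have [q0 dq dp] := hphi t It.
apply: is_derive_eq (is_derive_dot dq dp) _; rewrite !dotE -enorm_sqr.
by rewrite -[dot _ _]enorm_sqr; field; rewrite gt_eqF ?enorm_gt0.
Qed.

Lemma is_derive_kepler_speed {R : realType} {I : set R}
    {phi : R -> 'rV[R]_3 * 'rV[R]_3} {t : R} :
  kepler_orbit I phi -> I t ->
  is_derive t 1 (fun u => enorm (phi u).2 ^+ 2)
    (- (2 * dot (phi t).1 (phi t).2 / enorm (phi t).1 ^+ 3)).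
Proof.
move=> hphi It; have [q0 dq dp] := hphi t It.
have -> : (fun u => enorm (phi u).2 ^+ 2) = (fun u => dot (phi u).2 (phi u).2).
  by apply/funext => u; rewrite enorm_sqr.
apply: is_derive_eq (is_derive_dot dp dp) _; rewrite !dotE (dotC (phi t).2).
by field; rewrite gt_eqF ?enorm_gt0.
Qed.

(** The derivative is written as a polynomial in <q, p> and 1 / |q|, so that it visibly lies in the
    algebra used for smoothness. *)
Lemma is_derive_kepler_invr {R : realType} {I : set R}
    {phi : R -> 'rV[R]_3 * 'rV[R]_3} {t : R} :
  kepler_orbit I phi -> I t ->
  is_derive t 1 (fun u => (enorm (phi u).1)^-1)
    (- (dot (phi t).1 (phi t).2 * (enorm (phi t).1)^-1 ^+ 3)).
Proof.
move=> hphi It; have [q0 dq dp] := hphi t It.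
have rho0 : enorm (phi t).1 != 0 by rewrite gt_eqF ?enorm_gt0.
have h := @is_deriveV _ (fun u => enorm (phi u).1) _ _ _ rho0
  (is_derive_kepler_enorm hphi It).
apply: is_derive_eq h _.
by rewrite /GRing.scale /=; field.
Qed.

(** The kinetic term and 1 / |q| have the same derivative - <q, p> / |q|^3, so their difference is
    constant on the interval. *)
Lemma kepler_energy_cst {R : realType} (I : set R)
    (phi : R -> 'rV[R]_3 * 'rV[R]_3) (x y : R) :
  is_interval I -> kepler_orbit I phi -> I x -> I y ->
  hamiltonian (phi x) = hamiltonian (phi y).
Proof.
move=> itvI hphi.
apply: (is_derive0_cst_on (f := fun u => hamiltonian (phi u)) itvI) => t It.
have [q0 _ _] := hphi t It.
have h := is_deriveB (is_deriveZ 2^-1 (is_derive_kepler_speed hphi It))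
  (is_derive_kepler_invr hphi It).
apply: is_derive_eq h _; rewrite /GRing.scale /=.
by field; rewrite gt_eqF ?enorm_gt0.
Qed.

Lemma hyp_time_smooth {R : realType} (I : set R)
    (phi : R -> 'rV[R]_3 * 'rV[R]_3) (k t0 : R) :
  open I -> kepler_orbit I phi -> smooth_on I (hyp_time k phi t0).
Proof.
move=> oI hphi.
pose q i t := (phi t).1 0 i; pose p i t := (phi t).2 0 i.
pose w t := (enorm (phi t).1)^-1.
(* The generators are t, the q_i, the p_i and w = 1 / |q|. Taking w rather than |q| keeps all
   derivatives polynomial. *)
pose G : set (R -> R) := [set id] `|` range q `|` range p `|` [set w].
have Gid : generated_algebra G id by apply: generated_gen; left; left; left.
have Gq i : generated_algebra G (q i).
  by apply: generated_gen; left; left; right; exists i.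
have Gp i : generated_algebra G (p i).
  by apply: generated_gen; left; right; exists i.
have Gw : generated_algebra G w by apply: generated_gen; right.
have Gdot := generated_dot G _ _ _ Gq Gp.
apply: (generated_algebra_smooth I G oI); last first.
  rewrite (_ : hyp_time k phi t0 = cst (k ^+ 3) * (id + cst (- t0)) +
    cst (- k) * ((fun t => dot (phi t).1 (phi t).2) +
      cst (- dot (phi t0).1 (phi t0).2))).
    by do !apply: generatedD || apply: generatedM || apply: generated_cst.
  by apply/funext => t; rewrite /hyp_time !fctE mulNr.
have w3 : generated_algebra G (w * w * w) by do !apply: generatedM.
(* The derivatives of the generators are, in order, 1, p_i, - w^3 q_i and - <q, p> w^3. *)
move=> _ [[[->|[i _ <-]]|[i _ <-]]|->].
- by exists (cst 1) => [|t _]; [exact: generated_cst|exact: is_derive_id].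
- exists (p i) => // t /hphi[_ /is_derive_mxP/(_ 0 i)]//.
- exists (cst (-1) * (w * w * w) * q i).
    by apply: generatedM => //; apply: generatedM => //; exact: generated_cst.
  move=> t /hphi[q0 _ /is_derive_mxP/(_ 0 i) h]; apply: is_derive_eq h _.
  rewrite !mxE !fctE /w /q; field; by rewrite gt_eqF ?enorm_gt0.
- exists (cst (-1) * ((fun t => dot (phi t).1 (phi t).2) * (w * w * w))).
    by apply: generatedM; [exact: generated_cst|exact: generatedM].
  move=> t It; apply: is_derive_eq (is_derive_kepler_invr hphi It) _.
  by rewrite !fctE /w; ring.
Qed.

Lemma is_derive_hyp_time {R : realType} {I : set R}
    {phi : R -> 'rV[R]_3 * 'rV[R]_3} {k t : R} (t0 : R) :
  kepler_orbit I phi -> I t -> k ^+ 2 = 2 * hamiltonian (phi t) ->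
  is_derive t 1 (hyp_time k phi t0) (- (k / enorm (phi t).1)).
Proof.
move=> hphi It k2; have [q0 _ _] := hphi t It.
have h := is_deriveB
  (is_deriveZ (k ^+ 3) (is_deriveB (is_derive_id t 1) (is_derive_cst t0 t 1)))
  (is_deriveZ k (is_deriveB (is_derive_kepler_dot hphi It)
    (is_derive_cst (dot (phi t0).1 (phi t0).2) t 1))).
apply: is_derive_eq h _; rewrite /GRing.scale /=.
(* Splitting k^3 as k k^2 lets the energy relation turn k^3 - k (|p|^2 - 1 / |q|) into - k / |q|. *)
rewrite !subr0 mulr1 exprS k2 /hamiltonian enorm_sqr.
by field; rewrite gt_eqF ?enorm_gt0.
Qed.

Lemma is_derive_hyp_pos {R : realType} {I : set R}
    {phi : R -> 'rV[R]_3 * 'rV[R]_3} {k t : R} :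
  kepler_orbit I phi -> I t -> k ^+ 2 = 2 * hamiltonian (phi t) ->
  is_derive t 1 (fun u => hyp_pos k (phi u))
    (- (k / enorm (phi t).1) *: hyp_vel k (phi t)).
Proof.
move=> hphi It k2; have [q0 dq dp] := hphi t It.
have rho0 : enorm (phi t).1 != 0 by rewrite gt_eqF ?enorm_gt0.
have drho := is_derive_kepler_enorm hphi It.
have d0 := is_deriveB (is_deriveM (is_derive_kepler_speed hphi It) drho)
  (is_derive_cst (1 : R) t 1).
have d1 := is_deriveN (is_derive_scale (is_deriveZ k drho) dp).
apply: is_derive_eq (is_derive_vec13 d0 d1) _.
rewrite /hyp_vel vec13Z; congr vec13.
  rewrite /GRing.scale /= enorm_sqr.
  (* The energy relation enters the time component here: the factor |p|^2 - 2 / |q| is k^2. *)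
  transitivity (dot (phi t).1 (phi t).2 / enorm (phi t).1 *
      (dot (phi t).2 (phi t).2 - 2 / enorm (phi t).1)); first by field.
  transitivity (dot (phi t).1 (phi t).2 / enorm (phi t).1 * k ^+ 2);
    last by field.
  by rewrite k2 /hamiltonian enorm_sqr; field.
by apply/rowP => i; rewrite !mxE /= /GRing.scale /=; field.
Qed.

Lemma is_derive_hyp_vel {R : realType} {I : set R}
    {phi : R -> 'rV[R]_3 * 'rV[R]_3} {k t : R} :
  kepler_orbit I phi -> I t -> k ^+ 2 = 2 * hamiltonian (phi t) ->
  is_derive t 1 (fun u => hyp_vel k (phi u))
    (- (k / enorm (phi t).1) *: hyp_pos k (phi t)).
Proof.
move=> hphi It k2; have [q0 dq dp] := hphi t It.
have rho0 : enorm (phi t).1 != 0 by rewrite gt_eqF ?enorm_gt0.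
have dqp := is_derive_kepler_dot hphi It.
have d0 := is_deriveN (is_deriveZ k dqp).
have d1 := is_deriveN (is_deriveB
  (is_derive_scale (is_derive_kepler_invr hphi It) dq) (is_derive_scale dqp dp)).
apply: is_derive_eq (is_derive_vec13 d0 d1) _.
rewrite /hyp_pos vec13Z; congr vec13.
  by rewrite /GRing.scale /= enorm_sqr; field.
apply/rowP => i; rewrite !mxE.
(* The terms along q cancel, leaving (|p|^2 - 2 / |q|) p, which is k^2 p by the energy relation. *)
transitivity ((dot (phi t).2 (phi t).2 - 2 / enorm (phi t).1) * (phi t).2 0 i).
  by field.
transitivity (k ^+ 2 * (phi t).2 0 i); last by field.
by rewrite k2 /hamiltonian enorm_sqr; field.
Qed.

(** * Integration of the linear system for r and s *)

(** An integrating factor for M' = theta' M. *)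
Lemma is_derive_expR_scale0 {R : realType} {m n : nat} {theta : R -> R}
    {M : R -> 'M[R]_(m, n)} {t d : R} :
  is_derive t 1 theta d -> is_derive t 1 M (d *: M t) ->
  is_derive t 1 (fun u => expR (- theta u) *: M u) 0.
Proof.
move=> dtheta dM.
have h := @is_derive1_comp _ expR (- theta) _ _ _ (is_derive_expR _)
  (is_deriveN dtheta).
apply: is_derive_eq (is_derive_scale h dM) _ => /=.
by rewrite scalerA -scalerDl mulrN addNr scale0r.
Qed.

(** The system decouples: r + s grows at rate theta' and r - s at rate - theta'. Since theta
    vanishes at [t0], the two conserved vectors are r(t0) + s(t0) and r(t0) - s(t0), and half their
    recombination gives r and s. *)
Lemma hyp_line_of_derive {R : realType} (I : set R) (theta dtheta : R -> R)
    (r s : R -> 'rV[R]_(1 + 3)) (t0 t : R) :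
  is_interval I -> theta t0 = 0 ->
  (forall u, I u -> is_derive u 1 theta (dtheta u)) ->
  (forall u, I u -> is_derive u 1 r (dtheta u *: s u)) ->
  (forall u, I u -> is_derive u 1 s (dtheta u *: r u)) ->
  I t0 -> I t ->
  r t = hyp_line (r t0) (s t0) (theta t) /\
  s t = hyp_line (s t0) (r t0) (theta t).
Proof.
move=> itvI theta0 dth dr ds It0 It.
have hp u : I u ->
    is_derive u 1 (fun u => expR (- theta u) *: (r u + s u)) 0.
  move=> Iu; apply: (is_derive_expR_scale0 (dth u Iu)).
  apply: is_derive_eq (is_deriveD (dr u Iu) (ds u Iu)) _.
  by rewrite scalerDr addrC.
(* The double opposite comes from using the integrating factor with - theta in place of theta. *)
have hm u : I u ->
    is_derive u 1 (fun u => expR (- - theta u) *: (r u - s u)) 0.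
  move=> Iu; apply: (is_derive_expR_scale0 (is_deriveN (dth u Iu))).
  apply: is_derive_eq (is_deriveB (dr u Iu) (ds u Iu)) _.
  by rewrite -scalerBr scaleNr -scalerN opprB.
have := is_derive0_mx_cst_on itvI hp It It0.
have := is_derive0_mx_cst_on itvI hm It It0.
rewrite theta0 !oppr0 opprK expR0 !scale1r /hyp_line => em ep.
(* Writing s(t0) - r(t0) as - (r(t0) - s(t0)) lets both conserved vectors be replaced by their
   expressions at t; only algebra in exp(theta) remains. *)
rewrite -(opprB (r t0)) (addrC (s t0)) -em -ep.
rewrite !scalerN !scalerA; set e := expR (theta t); have e0 : e != 0.
  by rewrite gt_eqF ?expR_gt0.
rewrite expRN -/e; split; apply/rowP => i; rewrite !mxE; field => //.
Qed.

(** * The orbit as a reparametrized geodesic *)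

Theorem theorem5p8 (R : realType) (I : set R)
    (phi : R -> 'rV[R]_3 * 'rV[R]_3) (r s : R -> 'rV[R]_(1 + 3))
    (hI : open_interval I)
    (hphi : kepler_orbit I phi)
    (hH : forall t, I t -> Sigma_plus (phi t))
    (hS : forall t, I t ->
      S_plus (phi t) = (r t, s t, Num.sqrt (2 * hamiltonian (phi t)))) :
  (forall t, I t -> unit_cotangent (r t, s t)) /\
  exists (gamma : R -> 'rV[R]_(1 + 3)) (theta : R -> R),
    [/\ geodesic gamma, unit_speed gamma,
        smooth_on I theta, strictly_monotone_on I theta
      & forall t, I t ->
          r t = gamma (theta t) /\ s t = derive1 gamma (theta t)].
Proof.
have [[t0 It0] oI itvI] := hI.
have rs t : I t -> unit_cotangent (r t, s t).
  by move=> It; have := S_plus_unit_cotangent _ (hH t It); rewrite hS.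
split=> //; pose k := Num.sqrt (2 * hamiltonian (phi t0)).
(* Conservation of energy makes the third component of [S_plus] the same constant k on all of
   [I]. *)
have kE t : I t -> Num.sqrt (2 * hamiltonian (phi t)) = k.
  by move=> It; rewrite (kepler_energy_cst I phi t t0).
have k0 : 0 < k by rewrite sqrtr_gt0 mulr_gt0// (hH t0 It0).2.
have k2 t : I t -> k ^+ 2 = 2 * hamiltonian (phi t).
  by move=> It; rewrite -(kE t It) sqr_sqrtr// mulr_ge0// ltW// (hH t It).2.
have rE t : I t -> hyp_pos k (phi t) = r t.
  by move=> It; have := hS t It; rewrite /S_plus kE// => -[].
have sE t : I t -> hyp_vel k (phi t) = s t.
  by move=> It; have := hS t It; rewrite /S_plus kE// => -[].
have dth t It := is_derive_hyp_time t0 hphi It (k2 t It).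
exists (hyp_line (r t0) (s t0)), (hyp_time k phi t0); split.
- exact/hyp_line_geodesic/rs.
- exact/hyp_line_unit_speed/rs.
- exact: hyp_time_smooth.
(* theta is decreasing: its derivative - k / |q| is negative. *)
- right=> x y Ix Iy xy; rewrite -subr_lt0.
  have [c Ic ->] := MVT_is_interval itvI dth Ix Iy xy.
  have [q0 _ _] := hphi c Ic.
  by rewrite mulNr oppr_lt0 mulr_gt0 ?subr_gt0// divr_gt0// enorm_gt0.
- move=> t It; rewrite derive1_hyp_line -!rE// -!sE//.
  (* r and s are prescribed only on [I]; [hyp_pos] and [hyp_vel] along the orbit agree with them
     there and have known derivatives. *)
  apply: (hyp_line_of_derive I _ _ (fun u => hyp_pos k (phi u))
    (fun u => hyp_vel k (phi u)) _ _ itvI _ dth) => //.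
  + by rewrite /hyp_time !subrr !mulr0 subrr.
  + by move=> u Iu; exact: is_derive_hyp_pos hphi Iu (k2 u Iu).
  + by move=> u Iu; exact: is_derive_hyp_vel hphi Iu (k2 u Iu).
Qed.
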